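(* For every integer $m\ge0$, as formal power series in $z,y$, \[ \sum_{n\ge0}\sum_{k\ge0}\mathcal{B}_{n,m}^{(-k)}(a,q,L)\frac{z^n}{n!}\frac{y^k}{k!}=\frac{l^a e^{ay}}{1-\frac{l}{q}(1-e^{-qz})e^{\frac{ay}{a+m}}}. \]
   Context: Let $a,q,l$ be nonzero reals (with $a+j\neq0$ for integers $j\ge0$; $l^{a+i}$ means $l^al^i$). Let $\left\{ {n \atop i} \right\}$ be the Stirling numbers of the second kind. For integers $k\ge0$, $n,m\ge0$, define \[ \mathcal{B}_{n,m}^{(-k)}(a,q,L)=\frac{a^k}{(a+m)^k}\sum_{i=0}^{n}i!\,(-q)^{n-i}\,l^{i+a}\,(a+m+i)^k\left\{ {n \atop i} \right\}, \] i.e. the generalized $m$-poly-Bernoulli number $\frac{(a+m)^{k'}}{a^{k'}}\sum_{i=0}^{n}\frac{i!(-q)^{n-i}l^{i+a}}{(a+m+i)^{k'}}\left\{ {n \atop i} \right\}$ with $k'=-k$. *)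

(* Defs.v *)
From HB Require Import structures.
From mathcomp Require Import all_boot all_order all_algebra.
From mathcomp Require Import boolp reals sequences exp trigo.
From mathcomp Require Import complex.

Set Implicit Arguments.
Unset Strict Implicit.
Unset Printing Implicit Defensive.

Import Order.TTheory GRing.Theory Num.Theory.
Local Open Scope ring_scope.
Local Open Scope complex_scope.

(** * Formal power series *)

Record fps (R : Type) := FPS { fps_coef :> nat -> R }.

Lemma fpsP (R : Type) (u v : fps R) : (forall n, u n = v n) <-> u = v.
Proof.
by split=> [|-> //]; case: u v => u [v] uv; congr FPS; apply: funext.
Qed.

HB.instance Definition _ (R : Type) := gen_eqMixin (fps R).
HB.instance Definition _ (R : Type) := gen_choiceMixin (fps R).

Section Zmodule.
Variable R : zmodType.
Implicit Types u v w : fps R.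

Definition fps_zero : fps R := FPS (fun _ => 0).
Definition fps_add u v : fps R := FPS (fun n => u n + v n).
Definition fps_opp u : fps R := FPS (fun n => - u n).

Fact fps_addA : associative fps_add.
Proof. by move=> u v w; apply/fpsP => n /=; rewrite addrA. Qed.
Fact fps_addC : commutative fps_add.
Proof. by move=> u v; apply/fpsP => n /=; rewrite addrC. Qed.
Fact fps_add0 : left_id fps_zero fps_add.
Proof. by move=> u; apply/fpsP => n /=; rewrite add0r. Qed.
Fact fps_addN : left_inverse fps_zero fps_opp fps_add.
Proof. by move=> u; apply/fpsP => n /=; rewrite addNr. Qed.

HB.instance Definition _ :=
  GRing.isZmodule.Build (fps R) fps_addA fps_addC fps_add0 fps_addN.

Definition fpsC (c : R) : fps R := FPS (fun n => if n == 0%N then c else 0).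

Lemma fps_coefD u v n : (u + v) n = u n + v n. Proof. by []. Qed.
Lemma fps_coefN u n : (- u) n = - u n. Proof. by []. Qed.
Lemma fps_coef0 n : (0 : fps R) n = 0. Proof. by []. Qed.
Lemma fps_coef_sum I (r : seq I) (P : pred I) (F : I -> fps R) n :
  (\sum_(i <- r | P i) F i) n = \sum_(i <- r | P i) F i n.
Proof. by elim/big_rec2: _ => // i u x _ <-. Qed.
End Zmodule.

Section ComRing.
Variable R : comNzRingType.
Implicit Types u v w : fps R.

Definition fps_mul u v : fps R :=
  FPS (fun n => \sum_(i < n.+1) u i * v (n - i)%N).

Let trunc n u : {poly R} := \poly_(i < n.+1) u i.

Let coef_trunc n u i : (i <= n)%N -> (trunc n u)`_i = u i.
Proof. by move=> le_in; rewrite coef_poly ltnS le_in. Qed.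

Let mul_trunc N n u v : (n <= N)%N ->
  fps_mul u v n = (trunc N u * trunc N v)`_n.
Proof.
move=> le_nN; rewrite coefM; apply: eq_bigr => i _.
rewrite !coef_trunc //; first exact: leq_trans (leq_subr _ _) le_nN.
by rewrite (leq_trans _ le_nN) // -ltnS.
Qed.

Fact fps_mulA : associative fps_mul.
Proof.
move=> u v w; apply/fpsP => n.
transitivity (trunc n u * (trunc n v * trunc n w))`_n.
  rewrite coefM; apply: eq_bigr => i _.
  by rewrite coef_trunc -1?ltnS // -mul_trunc // leq_subr.
rewrite mulrA coefM; apply: eq_bigr => i _.
by rewrite coef_trunc ?leq_subr // -mul_trunc // -ltnS.
Qed.

Fact fps_mulC : commutative fps_mul.
Proof. by move=> u v; apply/fpsP => n; rewrite !(@mul_trunc n) // mulrC. Qed.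

Fact fps_mul1 : left_id (fpsC 1) fps_mul.
Proof.
move=> u; apply/fpsP => n /=.
by rewrite big_ord_recl /= mul1r subn0 big1 ?addr0 // => i _; rewrite mul0r.
Qed.

Fact fps_mulDl : left_distributive fps_mul (@fps_add R).
Proof.
move=> u v w; apply/fpsP => n /=; rewrite -big_split.
by apply: eq_bigr => i _; rewrite mulrDl.
Qed.

Fact fps_1_neq0 : fpsC (1 : R) != 0.
Proof.
by apply/eqP => /(congr1 (fun u : fps R => u 0%N)) /= /eqP; rewrite oner_eq0.
Qed.

HB.instance Definition _ := GRing.Zmodule_isComNzRing.Build (fps R)
  fps_mulA fps_mulC fps_mul1 fps_mulDl fps_1_neq0.

Lemma fps_coefM u v n : (u * v) n = \sum_(i < n.+1) u i * v (n - i)%N.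
Proof. by []. Qed.
Lemma fps_coef1 n : (1 : fps R) n = (n == 0%N)%:R.
Proof. by case: n. Qed.

Lemma fps_coefX_small u j n : u 0%N = 0 -> (n < j)%N -> (u ^+ j) n = 0.
Proof.
move=> u0; elim: j n => // j IHj n lt_nj.
rewrite exprS fps_coefM big1 // => -[[|i] lt_in] _ /=; first by rewrite u0 mul0r.
rewrite IHj ?mulr0 //; case: n lt_nj lt_in => // n lt_nj _.
by rewrite subSS (leq_ltn_trans (leq_subr _ _)).
Qed.
End ComRing.

Section ComUnitRing.
Variable R : comUnitRingType.
Implicit Types u v w : fps R.

Definition fps_unit : {pred fps R} := [pred u : fps R | u 0%N \is a GRing.unit].

(* When u has an invertible constant term u0, write u = u0 (1 - w); then w has
   no constant term, so u^-1 = u0^-1 \sum_j w^j, a sum in which only j <= n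
   contributes to the coefficient of index n. *)
Definition fps_inv u : fps R :=
  if u \in fps_unit then
    fpsC (u 0%N)^-1
    * FPS (fun n => \sum_(j < n.+1) ((1 - fpsC (u 0%N)^-1 * u) ^+ j) n)
  else u.

Fact fps_mulV : {in fps_unit, left_inverse 1 fps_inv *%R}.
Proof.
move=> u uU; rewrite /fps_inv uU; set c := fpsC _; set g := FPS _.
set w := 1 - c * u in g *; rewrite mulrAC.
have -> : c * u = 1 - w by rewrite /w opprB addrCA subrr addr0.
have w0 : w 0%N = 0.
  by rewrite /w fps_coefD fps_coefN fps_coefM big_ord1 /= mulVr ?subrr.
apply/fpsP => n; pose G := \sum_(j < n.+1) w ^+ j.
transitivity (((1 - w) * G) n).
  rewrite !fps_coefM; apply: eq_bigr => -[i lt_in] _ /=; congr (_ * _).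
  have le_ni : ((n - i).+1 <= n.+1)%N by rewrite ltnS leq_subr.
  rewrite /G fps_coef_sum (big_ord_widen n.+1 (fun j => (w ^+ j) (n - i)%N)) //.
  rewrite [RHS](bigID (fun j : 'I_n.+1 => (j < (n - i).+1)%N)) /=.
  rewrite [X in _ + X]big1 ?addr0 // => j.
  by rewrite -leqNgt; apply: fps_coefX_small.
by rewrite /G -opprB mulNr -subrX1 opprB fps_coefD fps_coefN
  (fps_coefX_small w0) // subr0.
Qed.

Fact fps_unitP u v : v * u = 1 -> u \in fps_unit.
Proof.
move/(congr1 (fun u : fps R => u 0%N)); rewrite fps_coefM big_ord1 /= => vu.
by apply/unitrPr; exists (v 0%N); rewrite mulrC.
Qed.

Fact fps_inv_out : {in [predC fps_unit], fps_inv =1 id}.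
Proof. by move=> u; rewrite inE /= /fps_inv => /negPf ->. Qed.

HB.instance Definition _ := GRing.ComNzRing_hasMulInverse.Build (fps R)
  fps_mulV fps_unitP fps_inv_out.
End ComUnitRing.

(** * Series in two variables z and y

   F[[z,y]] is represented as F[[y]][[z]]: for u : fps2 F, the coefficient of
   z^n y^k is u n k. *)

Notation fps2 F := (fps (fps F)).

Section Bivariate.
Variable F : fieldType.

Definition fps2_gen (c : nat -> nat -> F) : fps2 F :=
  FPS (fun n => FPS (fun k => c n k)).

Definition fps2C (c : F) : fps2 F := fpsC (fpsC c).

(* e^{cz} *)
Definition fps2_expz (c : F) : fps2 F := FPS (fun n => fpsC (c ^+ n / n`!%:R)).

(* e^{cy} *)
Definition fps2_expy (c : F) : fps2 F := fpsC (FPS (fun k => c ^+ k / k`!%:R)).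
End Bivariate.

(** * Powers of a nonzero real with real exponent

   As l may be negative, l^a is in general a complex number, determined up to
   the choice of a logarithm of l. The integer b indexes that choice: b = 0 is
   the principal one, and for l > 0 it yields the usual real power. *)

Section RealPower.
Variable R : realType.

Definition cexp (z : R[i]) : R[i] :=
  (expR (complex.Re z))%:C * (cos (complex.Im z) +i* sin (complex.Im z)).

Definition clog (b : int) (l : R) : R[i] :=
  ln `|l| +i* ((if l < 0 then pi else 0) + 2 * pi * b%:~R).

Definition cpow (b : int) (l a : R) : R[i] := cexp (a%:C * clog b l).

Lemma cexp_clog (b : int) (l : R) : l != 0 -> cexp (clog b l) = l%:C.
Proof.
move=> l_neq0; rewrite /cexp /clog /= lnK ?posrE ?normr_gt0 //.
have dpi : 2 * pi = pi *+ 2 :> R by rewrite mulr_natl.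
have [c s] : cos (2 * pi * b%:~R : R) = 1 /\ sin (2 * pi * b%:~R : R) = 0.
  have Hn n : cos (2 * pi * n%:R : R) = 1 /\ sin (2 * pi * n%:R : R) = 0.
    elim: n => [|n [IHc IHs]]; first by rewrite mulr0 cos0 sin0.
    by rewrite -(natr1 n) mulrDr mulr1 dpi cosD2pi sinD2pi -dpi.
  case: b => n; first exact: Hn.
  by rewrite NegzE mulrNz mulrN cosN sinN; have [-> ->] := Hn n.+1; rewrite oppr0.
rewrite cosD sinD c s !mulr1 !mulr0 subr0 addr0.
by case: ltrgt0P l_neq0 => // _ _; rewrite ?cospi ?sinpi ?cos0 ?sin0;
  apply/eqP; rewrite eq_complex /=; rewrite ?(mulr0, mul0r, mulr1, mulrN1, subr0,
    addr0, opprK) !eqxx.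
Qed.

Lemma cpow0_pos (l a : R) : 0 < l -> cpow 0 l a = (l `^ a)%:C.
Proof.
move=> l_gt0; rewrite /cpow /clog /cexp /= ltNge ltW //= gtr0_norm //.
rewrite mulr0z ?(mulr0, mul0r, addr0, subr0) cos0 sin0 /powR gt_eqF //.
by rewrite [_ +i* _](_ : _ = 1) ?mulr1.
Qed.
End RealPower.

(** * Generalized m-poly-Bernoulli numbers *)

Fixpoint stirling2 (n i : nat) : nat :=
  match n, i with
  | 0, 0 => 1
  | 0, _.+1 => 0
  | _.+1, 0 => 0
  | n'.+1, i'.+1 => (i'.+1 * stirling2 n' i'.+1 + stirling2 n' i')%N
  end.

(* The number of upper index -k; b is the choice of logarithm fixing l^a. *)
Definition mpoly_bernoulli (R : realType) (b : int) (a q l : R) (n m k : nat) :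
    R[i] :=
  (a ^+ k / (a + m%:R) ^+ k)%:C *
  \sum_(i < n.+1)
    (i`!%:R * (- q) ^+ (n - i))%:C * ((l ^+ i)%:C * cpow b l a) *
    ((a + m%:R + i%:R) ^+ k * (stirling2 n i)%:R)%:C.

(* The same number in the form given for an arbitrary integer upper index k',
   at k' = -k. *)
Lemma mpoly_bernoulliE (R : realType) (b : int) (a q l : R) (n m k : nat) :
  mpoly_bernoulli b a q l n m k =
  ((a + m%:R) ^ (- k%:Z) / a ^ (- k%:Z))%:C *
  \sum_(i < n.+1)
    (i`!%:R * (- q) ^+ (n - i))%:C * ((l ^+ i)%:C * cpow b l a) /
    ((a + m%:R + i%:R) ^ (- k%:Z))%:C * (stirling2 n i)%:R%:C.
Proof.
rewrite /mpoly_bernoulli -!exprnN invrK [a ^+ k / _]mulrC; congr (_ * _).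
apply: eq_bigr => i _; rewrite -exprnN -fmorphV invrK.
by rewrite [X in _ * X = _]rmorphM !mulrA.
Qed.

(* Main.v *)
Require Import Defs.
From HB Require Import structures.
From mathcomp Require Import all_boot all_order all_algebra.
From mathcomp Require Import boolp reals sequences exp trigo.
From mathcomp Require Import complex.
From mathcomp Require Import ring.

Import Order.TTheory GRing.Theory Num.Theory.
Local Open Scope ring_scope.
Local Open Scope complex_scope.

(** Expand the right-hand side as a geometric series in
    [(l / q) (1 - e^(- q z)) e^(a y / (a + m))]. The [j]-th power of
    [e^(c z) - 1] is [j! \sum_n S(n, j) c^n z^n / n!]: a series [u] without
    constant term such that [u' = c (1 + u)] satisfies
    [(u^j)' = c j (u^j + u^(j-1))], which is the recurrence of the Stirling
    numbers. The powers of the exponential in [y], multiplied by [e^(a y)],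
    are [e^(a (a + m + j) y / (a + m))]. *)

Section ComRing.
Variable R : comNzRingType.
Implicit Types (u v : fps R) (c : R).

Lemma fps_coefCM c u n : (fpsC c * u) n = c * u n.
Proof.
by rewrite fps_coefM big_ord_recl subn0 big1 ?addr0 // => i _; rewrite mul0r.
Qed.

Lemma fpsCM c d : fpsC (c * d) = fpsC c * fpsC d.
Proof.
by apply/fpsP => n; rewrite fps_coefCM /=; case: ifP; rewrite ?mulr0.
Qed.

Lemma fpsCX c j : fpsC (c ^+ j) = fpsC c ^+ j.
Proof. by elim: j => // j IHj; rewrite !exprS fpsCM IHj. Qed.

Lemma fpsCMn c j : fpsC (c *+ j) = fpsC c *+ j.
Proof.
elim: j => [|j IHj]; first by apply/fpsP => n /=; case: ifP.
by rewrite !mulrS -IHj; apply/fpsP => -[|n] //=; rewrite addr0.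
Qed.

Lemma fpsCN1X j : fpsC ((-1) ^+ j : R) = (-1) ^+ j.
Proof.
rewrite fpsCX; congr (_ ^+ _).
by apply/fpsP => -[|n] //=; rewrite oppr0.
Qed.

Lemma fps_coefMn u j n : (u *+ j) n = u n *+ j.
Proof. by elim: j => // j IHj; rewrite !mulrS -IHj. Qed.

Definition fps_deriv u : fps R := FPS (fun n => u n.+1 *+ n.+1).

Lemma fps_derivM u v : fps_deriv (u * v) = fps_deriv u * v + u * fps_deriv v.
Proof.
apply/fpsP => n; rewrite fps_coefD !fps_coefM /=.
(* The factor n + 1 is split as i + (n + 1 - i), one part for each factor of the product. The first
   sum then loses its term i = 0 and the second its term i = n + 1. *)
have -> : (\sum_(i < n.+2) u i * v (n.+1 - i)%N) *+ n.+1 =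
    \sum_(i < n.+2) u i *+ i * v (n.+1 - i)%N +
    \sum_(i < n.+2) u i * (v (n.+1 - i)%N *+ (n.+1 - i)).
  rewrite -big_split -sumrMnl; apply: eq_bigr => i _ /=.
  by rewrite mulrnAl mulrnAr -mulrnDr subnKC // -ltnS.
rewrite big_ord_recl mulr0n mul0r add0r; congr (_ + _).
rewrite big_ord_recr /= subnn mulr0n mulr0 addr0.
by apply: eq_bigr => i _; rewrite subSn // -ltnS.
Qed.

Lemma fps_derivX u j : fps_deriv (u ^+ j) = fps_deriv u * u ^+ j.-1 *+ j.
Proof.
elim: j => [|j IHj].
  by apply/fpsP => n; rewrite mulr0n /= mul0rn.
rewrite exprS fps_derivM IHj mulrS; congr (_ + _).
(* At j = 0 the truncated exponent [j.-1] is harmless, as its term is taken 0 times. *)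
case: j {IHj} => [|j]; first by rewrite !mulr0n mulr0.
by rewrite mulrnAr mulrCA -exprS.
Qed.

(** Clearing the denominator n! lets this hold over any commutative ring; it is needed with
    coefficients in [fps F], which is not a field. *)
Lemma fps_coefX_stirling2 c u :
  u 0%N = 0 -> fps_deriv u = fpsC c * (1 + u) ->
  forall n j, (u ^+ j) n *+ n`! = c ^+ n *+ (j`! * stirling2 n j).
Proof.
move=> u0 du; elim=> [|n IHn] [|j].
- by rewrite expr0.
- by rewrite fps_coefX_small // muln0 mulr0n mul0rn.
- by rewrite expr0 muln0 mulr0n /= mul0rn.
have dX : (u ^+ j.+1) n.+1 *+ n.+1 = c * ((u ^+ j) n + (u ^+ j.+1) n) *+ j.+1.
  transitivity (fps_deriv (u ^+ j.+1) n); first by [].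
  rewrite fps_derivX du fps_coefMn -mulrA fps_coefCM mulrDl mul1r -exprS.
  by rewrite fps_coefD.
(* In (n + 1)! = (n + 1) n!, the derivative absorbs n + 1 and the induction hypothesis, at j and at
   j + 1, absorbs n!. *)
rewrite factS mulrnA dX -mulrnA mulnC mulrnA -mulrnAr mulrnDl !IHn.
rewrite -mulrnDr mulrnAr -exprS -mulrnA; congr (_ *+ _).
by rewrite factS /=; ring.
Qed.
End ComRing.

(** As 1 - w has constant term 1, the normalisation in [fps_inv] is trivial and the series whose
    powers it sums is w itself. *)
Lemma fps_coef_geometric (R : comUnitRingType) (w : fps R) n :
  w 0%N = 0 -> (1 - w)^-1 n = \sum_(j < n.+1) (w ^+ j) n.
Proof.
move=> w0; have d0 : (1 - w) 0%N = 1 by rewrite fps_coefD fps_coefN w0 subr0.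
have dU : (1 - w) \in @fps_unit R by rewrite inE d0 unitr1.
rewrite /GRing.inv /= /fps_inv dU d0 invr1.
have -> : fpsC (1 : R) = 1 by [].
by rewrite !mul1r opprB addrC subrK.
Qed.

Section Exponential.
Variable F : numFieldType.
Implicit Types c d : F.

Lemma natf_fact_neq0 n : n`!%:R != 0 :> F.
Proof. by rewrite pnatr_eq0 -lt0n fact_gt0. Qed.

(** The exponential as a series in y alone: [fps2_expy c] is [fpsC (fps_exp c)] by conversion. *)
Definition fps_exp c : fps F := FPS (fun n => c ^+ n / n`!%:R).

Lemma fps_expD c d : fps_exp (c + d) = fps_exp c * fps_exp d.
Proof.
apply/fpsP => n; rewrite fps_coefM /= addrC exprDn mulr_suml.
apply: eq_bigr => i _; have le_in : (i <= n)%N by rewrite -ltnS.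
rewrite -(bin_fact le_in) -mulr_natr !natrM.
have := natf_fact_neq0 i; have := natf_fact_neq0 (n - i).
have : 'C(n, i)%:R != 0 :> F by rewrite pnatr_eq0 -lt0n bin_gt0.
by move=> *; field; do !(apply/andP; split).
Qed.

Lemma fps_expX c j : fps_exp c ^+ j = fps_exp (c *+ j).
Proof.
elim: j => [|j IHj]; last by rewrite exprS IHj mulrS fps_expD.
by apply/fpsP => -[|n]; rewrite /= ?divr1 // expr0n mul0r.
Qed.

Lemma fps2_coef_expz_sub1X c j n :
  ((fps2_expz c - 1) ^+ j) n =
  fpsC (c ^+ n * (j`! * stirling2 n j)%:R / n`!%:R).
Proof.
have e0 : (fps2_expz c - 1) 0%N = 0.
  by rewrite fps_coefD fps_coefN /= divr1 subrr.
(* The derivative is in z, over the ring of series in y, so the scalar c is the series [fpsC c]. *)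
have de : fps_deriv _ (fps2_expz c - 1) =
    fpsC (fpsC c) * (1 + (fps2_expz c - 1)).
  apply/fpsP => i; rewrite [1 + _]addrC subrK fps_coefCM /= subr0 -fpsCM.
  rewrite -fpsCMn -mulr_natr factS natrM exprS; congr fpsC.
  by field; rewrite natf_fact_neq0 nat1r pnatr_eq0.
have := fps_coefX_stirling2 _ _ _ e0 de n j.
rewrite -fpsCX -fpsCMn => eqn.
rewrite fpsCM mulr_natr -eqn mulrnAl -mulrnAr -fpsCMn -[_^-1 *+ _]mulr_natr.
rewrite mulVf ?natf_fact_neq0 //.
by rewrite [X in _ * X](_ : _ = 1) ?mulr1.
Qed.

Lemma fps2_coef_geometric_exp (A x c d q : F) n k :
  (fps2C A * fps2_expy c /
    (1 - fps2C x * (1 - fps2_expz (- q)) * fps2_expy d)) n k =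
  \sum_(j < n.+1) A * x ^+ j * ((c + d *+ j) ^+ k / k`!%:R) *
    ((-1) ^+ j * (- q) ^+ n * (j`! * stirling2 n j)%:R / n`!%:R).
Proof.
set w := fps2C x * _ * _.
(* The variables are separated: the first factor is constant in z and the second is free of y, so
   each is raised to the power j on its own. *)
have wE : w = fpsC (fpsC x * fps_exp d) * (1 - fps2_expz (- q)).
  by rewrite /w fpsCM mulrAC.
have w0 : w 0%N = 0.
  rewrite wE fps_coefCM fps_coefD fps_coefN /= divr1.
  by rewrite [fpsC 1](_ : _ = 1) // subrr mulr0.
rewrite -fpsCM fps_coefCM fps_coef_geometric // mulr_sumr fps_coef_sum.
apply: eq_bigr => j _.
have powB : (1 - fps2_expz (- q)) ^+ j =
    fpsC (fpsC ((-1) ^+ j)) * (fps2_expz (- q) - 1) ^+ j.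
  by rewrite !fpsCN1X -[1 - _]opprB; apply: exprNn.
rewrite wE exprMn -fpsCX powB !fps_coefCM fps2_coef_expz_sub1X -fpsCM.
rewrite exprMn fps_expX !mulrA.
set s := (-1) ^+ j * _ * _ / _.
rewrite -fpsCX [X in fps_coef X k](_ : _ =
  fpsC (A * x ^+ j * s) * (fps_exp c * fps_exp (d *+ j))).
  by rewrite -fps_expD fps_coefCM /= /s; ring.
by rewrite !fpsCM /fps_exp; ring.
Qed.
End Exponential.

Theorem theorem8 (R : realType) (b : int) (a q l : R)
  (a_neq0 : a != 0) (q_neq0 : q != 0) (l_neq0 : l != 0)
  (aDj_neq0 : forall j : nat, a + j%:R != 0) (m : nat) :
  fps2_gen (fun n k : nat =>
    mpoly_bernoulli b a q l n m k / (n`!%:R * k`!%:R)) =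
  fps2C (cpow b l a) * fps2_expy a%:C /
  (1 - fps2C (l / q)%:C * (1 - fps2_expz (- q)%:C)
       * fps2_expy (a / (a + m%:R))%:C).
Proof.
apply/fpsP => n; apply/fpsP => k.
rewrite [(- q)%:C]rmorphN fps2_coef_geometric_exp /= /mpoly_bernoulli.
rewrite mulr_sumr mulr_suml; apply: eq_bigr => -[j /=]; rewrite ltnS => le_jn _.
set A := cpow b l a.
(* Together with (-1)^j and the (l / q)^j of the geometric series, the factor (-q)^j leaves l^j. *)
have -> : (- q%:C) ^+ n = (- q%:C) ^+ (n - j) * (- q%:C) ^+ j.
  by rewrite -exprD subnK.
have -> : a%:C + (a / (a + m%:R))%:C *+ j =
    (a * (a + m%:R + j%:R) / (a + m%:R))%:C.
  by rewrite -rmorphMn -rmorphD; congr _%:C; have := aDj_neq0 m => ?; field.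
rewrite natrM !(rmorphM, rmorphXn, rmorphN, rmorph_nat, fmorphV).
rewrite !exprMn !exprVn.
rewrite [(- q%:C) ^+ j]exprNn /=.
have -> (x y : R[i]) : (-1) ^+ j * (x * ((-1) ^+ j * y)) = x * y.
  by rewrite mulrCA signrMK.
have qX_neq0 : q%:C ^+ j != 0 by rewrite -rmorphXn fmorph_eq0 expf_neq0.
have amX_neq0 : (a + m%:R)%:C ^+ k != 0.
  by rewrite -rmorphXn fmorph_eq0 expf_neq0.
set Q := q%:C ^+ j in qX_neq0 *; set M := (a + m%:R)%:C ^+ k in amX_neq0 *.
move: (_ ^+ (n - j)) ((a + m%:R + j%:R)%:C ^+ k) => X Y.
by field; rewrite !natf_fact_neq0 amX_neq0.
Qed.
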